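(* For every integer $\delta\ge 2$, every integer $k\in\{0,1,\ldots,(\delta/2-1)(\delta+1)\}$ and every integer $N$, there exists a connected graph $F$ with minimum degree $\delta$ and $|V(F)|\ge N$ such that $$\mathrm{wsat}(n,F)=\left(\frac{\delta}{2}+\frac{k}{\delta+1}\right)n+O(1)\qquad (n\to\infty),$$ where the implied constant may depend on $F$ (but not on $n$).
   Context: All graphs are finite and simple. Given a graph $F$, an $F$-bootstrap percolation process is a sequence of graphs $H_0\subset H_1\subset\cdots\subset H_m$ on the same vertex set such that, for each $i=1,\ldots,m$, $H_i$ is obtained from $H_{i-1}$ by adding one edge that belongs to a copy of $F$ (a not necessarily induced subgraph isomorphic to $F$) in $H_i$. A graph $H$ on $[n]=\{1,\ldots,n\}$ is weakly $F$-saturated if there is an $F$-bootstrap percolation process $H=H_0\subset\cdots\subset H_m=K_n$. The number $\mathrm{wsat}(n,F)$ is the minimum number of edges of a weakly $F$-saturated graph on $[n]$. *)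

(* Defs.v *)
From HB Require Import structures.
From mathcomp Require Import all_boot all_order all_algebra.

Set Implicit Arguments.
Unset Strict Implicit.
Unset Printing Implicit Defensive.

Record sgraph (V : finType) := SGraph {
  edges : {set {set V}};
  _ : [forall e in edges, #|e| == 2]
}.

HB.instance Definition _ (V : finType) := [isSub for @edges V].
HB.instance Definition _ (V : finType) := [Finite of sgraph V by <:].

(* Since all edges have exactly two elements, adj G x x is false. *)
Definition adj (V : finType) (G : sgraph V) : rel V :=
  fun x y => [set x; y] \in edges G.

Definition degree (V : finType) (G : sgraph V) (x : V) : nat :=
  #|[set y | adj G x y]|.

(* Degrees are smaller than #|V|, so the default value #|V| only plays a role
   when V is empty. *)
Definition min_degree (V : finType) (G : sgraph V) : nat :=
  \big[minn/#|V|]_(x : V) degree G x.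

Definition connected (V : finType) (G : sgraph V) : bool :=
  (0 < #|V|) && [forall x, forall y, connect (adj G) x y].

Fact complete_subproof (V : finType) :
  [forall e in [set e : {set V} | #|e| == 2], #|e| == 2].
Proof. by apply/forall_inP => e; rewrite inE. Qed.

Definition complete (V : finType) : sgraph V := SGraph (complete_subproof V).

(* An injective map f : W -> V sending edges of F to edges of H is the same as
   a copy of F in H with its identification with F; the copy is not required
   to be induced, and its edges are the images f @: d of the edges d of F. *)
Definition in_copy (W V : finType) (F : sgraph W) (H : sgraph V)
    (e : {set V}) : bool :=
  [exists f : {ffun W -> V},
    [&& injectiveb f,
        [forall d in edges F, f @: d \in edges H] &
        [exists d in edges F, f @: d == e]]].

Definition bootstrap_step (W V : finType) (F : sgraph W) : rel (sgraph V) :=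
  fun H H' => [exists e : {set V},
    [&& e \notin edges H, edges H' == e |: edges H & in_copy F H' e]].

(* By connectP, this is the existence of a finite (possibly empty) sequence of
   bootstrap steps leading from H to the complete graph. *)
Definition weakly_saturated (W V : finType) (F : sgraph W) (H : sgraph V) :
    bool :=
  connect (bootstrap_step F) H (complete V).

(* The minimum is over a nonempty set, see weakly_saturated_complete. *)
Definition wsat (n : nat) (W : finType) (F : sgraph W) : nat :=
  #|edges [arg min_(H < complete 'I_n | weakly_saturated F H) #|edges H| ]|.

Lemma weakly_saturated_complete (W V : finType) (F : sgraph W) :
  weakly_saturated F (complete V).
Proof. exact: connect0. Qed.

Lemma wsatP (n : nat) (W : finType) (F : sgraph W) :
  (exists2 H : sgraph 'I_n, weakly_saturated F H & #|edges H| = wsat n F) /\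
  (forall H : sgraph 'I_n, weakly_saturated F H -> wsat n F <= #|edges H|).
Proof.
rewrite /wsat; case: arg_minnP => [|H HF Hmin].
  exact: weakly_saturated_complete.
by split=> //; exists H.
Qed.

Lemma adj_sym (V : finType) (G : sgraph V) : symmetric (adj G).
Proof. by move=> x y; rewrite /adj setUC. Qed.

Lemma adj_irrefl (V : finType) (G : sgraph V) : irreflexive (adj G).
Proof.
move=> x; rewrite /adj setUid.
by apply/negP => /(forall_inP (valP G)); rewrite cards1.
Qed.

(* Main.v *)
(* Put m = delta + 1 and c = delta/2 + k/m, so that c m = C(m,2) + k.  The graph
   F is a huge clique together with a vertex sending delta edges to it and a
   copy T of K_m sending k + 1 edges to it, spread evenly over T and with distinct
   ends in the clique.

   Every nonempty X in V(F) meets at least c|X| + 1 edges of F.  During a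
   bootstrap process started at H one can then maintain a set P containing all
   the added edges and spanning at least c|P| edges of H: if the copy of F used
   in a step leaves P, say in X, then all of its edges meeting X, except the new
   one, are edges of H.  In the end this gives |E(H)| >= cn.

   Conversely, take a large clique and disjoint copies of T, one of the k + 1
   edges from each copy to the clique being removed; this is c edges per vertex.
   The missing edge can be added; then, redirecting edges and permuting T, all
   edges from the copy to the clique; and finally everything else. *)
Require Import Defs.
From mathcomp Require Import all_boot all_order all_algebra.
From mathcomp Require Import fingroup perm zify lra ring.

Set Implicit Arguments.
Unset Strict Implicit.
Unset Printing Implicit Defensive.

Import Order.TTheory GRing.Theory Num.Theory.

(** * Edges meeting a vertex set, and graphs given by a relation *)

Section SimpleGraphs.
Variable V : finType.
Implicit Types (G H : sgraph V) (X P : {set V}) (e : {set V}).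

Definition touching G X : {set {set V}} :=
  [set e in edges G | ~~ [disjoint e & X]].

Definition inside G X : {set {set V}} := [set e in edges G | e \subset X].

Lemma edgeP G e : reflect (exists2 p, e = [set p.1; p.2] & adj G p.1 p.2)
                          (e \in edges G).
Proof.
apply: (iffP idP) => [eG | [[x y] -> //]].
have /cards2P[x [y [_ e_xy]]] : #|e| == 2 by apply: (forall_inP (valP G)).
by exists (x, y) => /=; rewrite ?/adj -e_xy.
Qed.

Lemma adj_neq G x y : adj G x y -> x != y.
Proof. by apply: contraTneq => ->; rewrite adj_irrefl. Qed.

(* Both sides count the ordered pairs of adjacent vertices, at least one in X. *)
Lemma card_touching G X :
  2 * #|touching G X| =
  \sum_(x in X) (degree G x + #|[set y | adj G x y] :\: X|).
Proof.
pose P := [set p : V * V | adj G p.1 p.2 && ((p.1 \in X) || (p.2 \in X))].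
have fiber e : e \in touching G X ->
    #|[set p in P | [set p.1; p.2] == e]| = 2.
  rewrite inE => /andP[/edgeP[[x y] /= -> xy] meets].
  have nxy := adj_neq xy.
  suff -> : [set p in P | [set p.1; p.2] == [set x; y]] = [set (x, y); (y, x)].
    by rewrite cards2 xpair_eqE (negPf nxy).
  have XY : (x \in X) || (y \in X).
    apply: contraR meets; rewrite negb_or => /andP[xX yX].
    by rewrite disjoint_subset; apply/subsetP => z; rewrite !inE => /orP[]/eqP->.
  apply/setP => -[a b]; rewrite !inE /= !xpair_eqE.
  apply/idP/idP; last first.
    case/orP=> /andP[/eqP-> /eqP->]; first by rewrite xy XY eqxx.
    by rewrite adj_sym xy orbC XY setUC eqxx.
  case/andP=> /andP[/adj_neq nab _] /eqP E; move: nab.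
  have: a \in [set x; y] by rewrite -E set21.
  have: b \in [set x; y] by rewrite -E set22.
  by rewrite !inE => /orP[]/eqP-> /orP[]/eqP->; rewrite ?eqxx ?orbT.
have cardP : #|P| = 2 * #|touching G X|.
  rewrite -sum1_card (partition_big (fun p => [set p.1; p.2]) (mem (touching G X))) /=.
    rewrite mulnC -sum_nat_const; apply: eq_bigr => e eT.
    by rewrite -(fiber e eT) -sum1_card; apply: eq_bigl => p; rewrite !inE.
  move=> [x y]; rewrite !inE /= => /andP[xy XY]; rewrite -[_ \in edges G]/(adj G x y) xy /=.
  apply/pred0Pn; case/orP: XY => ?; [exists x|exists y]; by rewrite /= !inE eqxx ?orbT.
rewrite -cardP -sum1_card.
have -> : \sum_(p in P) 1 = \sum_x \sum_(y | (x, y) \in P) 1.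
  by rewrite pair_big_dep /=; apply: eq_bigl => -[x y].
(* Pairs with first entry in [X] give the degrees. The other pairs have their second entry in [X];
   after exchanging the sums they count the neighbours outside [X]. *)
rewrite (bigID (mem X)) /= big_split /=; congr (_ + _).
  apply: eq_bigr => x xX; rewrite /degree -sum1_card; apply: eq_bigl => y.
  by rewrite !inE /= xX andbT.
rewrite (exchange_big_dep (mem X)) /=; last first.
  by move=> x y xX; rewrite !inE /= (negPf xX) /= => /andP[].
apply: eq_bigr => y yX; rewrite -sum1_card; apply: eq_bigl => x.
by rewrite !inE /= yX orbT andbT adj_sym.
Qed.

Lemma card_inside_touching G X : #|edges G| = #|inside G (~: X)| + #|touching G X|.
Proof.
rewrite -(cardsID (inside G (~: X)) (edges G)); congr (_ + _).
  by apply: eq_card => e; rewrite !inE; case: (e \in edges G); rewrite ?andbF.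
by apply: eq_card => e; rewrite !inE -disjoints_subset andbC; case: (e \in edges G).
Qed.

Fact relgraph_subproof (r : rel V) :
  [forall e in [set [set p.1; p.2] | p : V * V & (p.1 != p.2) && r p.1 p.2],
     #|e| == 2].
Proof.
by apply/forall_inP => e /imsetP[p]; rewrite inE => /andP[p12 _] ->; rewrite cards2 p12.
Qed.

(** Unordered pairs symmetrise [r] and the filter drops loops, so a graph can be specified by
    listing each kind of edge in one direction only. *)
Definition relgraph (r : rel V) : sgraph V := SGraph (relgraph_subproof r).

Lemma adj_relgraph (r : rel V) x y :
  adj (relgraph r) x y = (x != y) && (r x y || r y x).
Proof.
apply/imsetP/andP => [[[a b]] | [nxy /orP[rxy | ryx]]].
- rewrite inE /= => /andP[nab rab] E.
  have: x \in [set a; b] by rewrite -E set21.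
  have: y \in [set a; b] by rewrite -E set22.
  have: a \in [set x; y] by rewrite E set21.
  have: b \in [set x; y] by rewrite E set22.
  rewrite !inE => /orP[]/eqP eb /orP[]/eqP ea _ _; move: nab rab; rewrite ea eb ?eqxx //.
    by rewrite eq_sym => -> ->; rewrite orbT.
  by move=> -> ->.
- by exists (x, y); rewrite // inE nxy.
- by exists (y, x); [rewrite inE /= eq_sym nxy | apply: setUC].
Qed.

End SimpleGraphs.

(** * The lower bound for expanding graphs *)

Section LowerBound.
Variables (W : finType) (F : sgraph W) (p q : nat).
Hypothesis expanding :
  forall X : {set W}, X != set0 -> p * #|X| + q <= q * #|touching F X|.

(** Here [H] is the initial graph and [G] the current one. If the copy leaves [P], it does so in the
    image of [X]. Its edges meeting [X] are not inside [P], so apart from the new edge they lie in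
    [H], and they are new to the edge count when the image of [X] joins [P]. The surplus [q] in
    [expanding] pays for the one exception. *)
Lemma bootstrap_step_invariant (V : finType) (H G G' : sgraph V) (P : {set V}) :
    edges G \subset edges H :|: powerset P -> p * #|P| <= q * #|inside H P| ->
    bootstrap_step F G G' ->
  exists2 P' : {set V}, edges G' \subset edges H :|: powerset P' &
                        p * #|P'| <= q * #|inside H P'|.
Proof.
move=> sGP dP /existsP[e /and3P[_ /eqP defG' /existsP[f]]].
case/and3P=> /injectiveP injf /forall_inP fG' /exists_inP[d0 d0F /eqP def_e].
have [eP | neP] := boolP (e \subset P).
  exists P => //; rewrite defG' subUset sGP andbT sub1set !inE eP orbT //.
pose X := f @^-1: (~: P); pose P' := P :|: f @: X.
have fP' x : f x \in P'.
  rewrite !inE; have [//|fxP] := boolP (f x \in P).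
  by apply: imset_f; rewrite !inE.
have X0 : X != set0.
  have /subsetPn[y ye yP] := neP; move: ye; rewrite -def_e => /imsetP[x _ yx].
  by apply/set0Pn; exists x; rewrite !inE -yx.
have sPP' : P \subset P' by apply: subsetUl.
exists P'.
  rewrite defG' subUset sub1set; apply/andP; split.
    rewrite !inE -def_e; apply/orP; right; apply/subsetP => _ /imsetP[x _ ->] //.
  apply: subset_trans sGP _; by apply: setUS; rewrite powersetS.
pose D := [set f @: (d : {set W}) | d in touching F X].
have cardD : #|D| = #|touching F X|.
  by apply: card_imset; apply: imset_inj.
have sub : inside H P :|: (D :\ e) \subset inside H P'.
  apply/subsetP => d; rewrite in_setU => /orP[|].
    by rewrite !inE => /andP[-> /subset_trans->].
  rewrite in_setD1 => /andP[de /imsetP[d']]; rewrite inE => /andP[d'F meets] dd'.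
  have dG' : d \in edges G' by rewrite dd' fG'.
  have ndP : ~~ (d \subset P).
    apply: contra meets => dP'; rewrite disjoint_subset; apply/subsetP => x xd'.
    by rewrite !inE negbK (subsetP dP') // dd' imset_f.
  move: dG'; rewrite defG' in_setU1 (negPf de) /= => /(subsetP sGP).
  rewrite !inE (negPf ndP) orbF => -> /=.
  by apply/subsetP => y; rewrite dd' => /imsetP[x _ ->].
have disj : [disjoint inside H P & D :\ e].
  rewrite disjoint_subset; apply/subsetP => d; rewrite !inE => /andP[_ dP'].
  apply/negP => /andP[_ /imsetP[d']]; rewrite inE => /andP[d'F meets] dd'.
  case/negP: meets; rewrite disjoint_subset; apply/subsetP => x xd'.
  by rewrite !inE negbK (subsetP dP') // dd' imset_f.
have := subset_leq_card sub; rewrite cardsU (disjoint_setI0 disj) cards0 subn0.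
have cardP' : #|P'| = #|P| + #|X|.
  rewrite cardsU (_ : P :&: f @: X = set0) ?cards0 ?subn0 ?card_imset //.
  apply/setP => y; rewrite !inE; apply/negP => /andP[yP /imsetP[x]].
  by rewrite !inE => /negP fxP yx; rewrite -yx in fxP.
have := cardsD1 e D; rewrite cardD cardP' => cardT sum_le.
have : q * (#|inside H P| + #|touching F X|) <= q * #|inside H P'|.+1.
  rewrite leq_mul2l cardT addnCA -add1n; apply/orP; right.
  by apply: leq_add sum_le; apply: leq_b1.
have := expanding X0; rewrite !mulnDr mulnS; lia.
Qed.

Lemma connect_invariant (V : finType) (H G : sgraph V) :
    connect (bootstrap_step F) H G ->
  exists2 P : {set V}, edges G \subset edges H :|: powerset P &
                       p * #|P| <= q * #|inside H P|.
Proof.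
case/connectP => s; have: exists2 P : {set V},
    edges H \subset edges H :|: powerset P & p * #|P| <= q * #|inside H P|.
  by exists set0; rewrite ?subsetUl // cards0 muln0.
(* Only the occurrences of [H] as the current graph are generalised; the initial graph in the
   invariant stays fixed. *)
move: {1 4 5}H => G'.
elim: s G' => [|G2 s IHs] G1 /= inv; first by move=> _ ->.
case/andP=> step /IHs; apply; case: inv => P sGP dP.
exact: bootstrap_step_invariant sGP dP step.
Qed.

(** The final graph is complete, so a vertex outside [P] has full degree [n.-1] already in [H]. Each
    edge meets at most two such vertices, so for large [n] they account for at least [p / q] edges
    each, on top of those inside [P]. *)
Lemma wsat_lower_bound n : 2 * p <= q * n.-1 -> p * n <= q * wsat n F.
Proof.
move=> n_large; have [[H satH <-] _] := wsatP n F.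
have [P sP dP] := connect_invariant satH.
have deg x : x \notin P -> degree H x = n.-1.
  move=> xP; rewrite /degree -[in RHS](card_ord n) -(cardsC1 x); apply: eq_card => y.
  rewrite !inE; apply/idP/idP => [/adj_neq|yx]; first by rewrite eq_sym.
  have /(subsetP sP) : [set x; y] \in edges (complete 'I_n).
    by rewrite inE cards2 (eq_sym x) yx.
  by rewrite !inE subUset sub1set (negPf xP) orbF.
have := card_inside_touching H (~: P); have := card_touching H (~: P).
rewrite setCK => cT ->.
have : n.-1 * #|~: P| <= 2 * #|touching H (~: P)|.
  rewrite cT mulnC -sum_nat_const; apply: leq_sum => x; rewrite inE => xP.
  by rewrite deg // leq_addr.
move=> /(leq_mul (leqnn q)) touch.
have := leq_mul n_large (leqnn #|~: P|).
have := cardsC P; rewrite card_ord => cardP.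
by rewrite -[X in p * X]cardP !mulnDr; nia.
Qed.

End LowerBound.

(** * Graphs closed under bootstrap steps, and the upper bound *)

Section Percolation.
Variables (W : finType) (F : sgraph W).

(* No edge can be added to G by a bootstrap step. *)
Definition percolated (V : finType) (G : sgraph V) :=
  forall (f : W -> V) x y, injective f -> adj F x y ->
    (forall x' y', adj F x' y' -> [set x'; y'] != [set x; y] ->
       adj G (f x') (f y')) ->
  adj G (f x) (f y).

Lemma connect_bootstrap_subset (V : finType) (H G : sgraph V) :
  connect (bootstrap_step F) H G -> edges H \subset edges G.
Proof.
case/connectP => s; elim: s H => [|H' s IHs] H /=; first by move=> _ ->.
case/andP=> /existsP[e /and3P[_ /eqP defH' _]] /IHs sub /sub.
by apply: subset_trans; rewrite defH' subsetUr.
Qed.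

(** A reachable graph with the maximum number of edges admits no further step, so it is percolated.
    This replaces explicit percolation sequences by a closure argument. *)
Lemma percolated_weakly_saturated (V : finType) (H : sgraph V) :
    (forall G : sgraph V, edges H \subset edges G -> percolated G ->
       forall x y, x != y -> adj G x y) ->
  weakly_saturated F H.
Proof.
move=> allG; pose Q (G : sgraph V) := connect (bootstrap_step F) H G.
case: (@arg_maxnP _ H Q (fun G => #|edges G|) (connect0 _ H)) => G HG maxG.
have sHG := connect_bootstrap_subset HG.
have completeG : forall x y, x != y -> adj G x y.
  apply: allG sHG _ => f x y injf Fxy fG; apply: contraT => nGxy.
  pose e := [set f x; f y].
  have e2 : [forall d in e |: edges G, #|d| == 2].
    apply/forall_inP => d; rewrite in_setU1 => /orP[/eqP-> | /(forall_inP (valP G))//].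
    by rewrite cards2 (inj_eq injf) (adj_neq Fxy).
  have stepG : bootstrap_step F G (SGraph e2).
    apply/existsP; exists e; rewrite [_ \notin _]nGxy eqxx /=.
    apply/existsP; exists (finfun f); apply/and3P; split.
    - by apply/injectiveP => u v; rewrite !ffunE => /injf.
    - apply/forall_inP => d /edgeP[[u v] /= -> Fuv].
      rewrite imsetU1 imset_set1 !ffunE in_setU1.
      have [E | /(fG _ _ Fuv) Guv] := eqVneq [set u; v] [set x; y]; last by apply/orP; right.
      have: (finfun f) @: [set u; v] = (finfun f) @: [set x; y] by rewrite E.
      by rewrite !imsetU1 !imset_set1 !ffunE => ->; rewrite eqxx.
    - by apply/exists_inP; exists [set x; y]; rewrite // imsetU1 imset_set1 !ffunE.
  have := maxG (SGraph e2) (connect_trans HG (connect1 stepG)).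
  by rewrite /= cardsU1 [_ \notin _]nGxy add1n ltnn.
rewrite /weakly_saturated (_ : complete V = G) //; apply: val_inj; apply/setP => e /=.
apply/idP/idP => [|eG]; last by rewrite inE (forall_inP (valP G)).
by rewrite inE => /cards2P[x [y [xy ->]]]; apply: completeG.
Qed.

(** Since [wsat] speaks of ordinals only, [H] is transported along [enum_rank], and a percolated
    graph above its image is pulled back to [V]. *)
Lemma wsat_upper_bound (V : finType) (H : sgraph V) :
    (forall G : sgraph V, edges H \subset edges G -> percolated G ->
       forall x y, x != y -> adj G x y) ->
  wsat #|V| F <= #|edges H|.
Proof.
move=> allG; pose psi := @enum_rank V; pose im (e : {set V}) := psi @: e.
have inj_psi : injective psi by apply: enum_rank_inj.
have im2 : [forall e in im @: edges H, #|e| == 2].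
  apply/forall_inP => e /imsetP[d dH ->]; rewrite card_imset //.
  exact: (forall_inP (valP H)).
have -> : #|edges H| = #|edges (SGraph im2)|.
  by rewrite card_imset //; apply: imset_inj.
have [_ -> //] := wsatP #|V| F; apply: percolated_weakly_saturated => G sHG percG x y xy.
pose G' := relgraph (fun u v => adj G (psi u) (psi v)).
have adjG' u v : adj G' u v = adj G (psi u) (psi v).
  rewrite adj_relgraph (adj_sym G (psi v)) orbb.
  by have [->|//] := eqVneq u v; rewrite adj_irrefl.
rewrite -(enum_valK x) -(enum_valK y) -adjG'; apply: allG.
- apply/subsetP => e eH; have /edgeP[[u v] /= defe _] := eH.
  rewrite defe [_ \in _]adjG' /adj; apply: (subsetP sHG).
  by apply/imsetP; exists e; rewrite // /im defe imsetU1 imset_set1.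
- move=> f u v injf Fuv fG'; rewrite adjG'; apply: (percG (psi \o f)) => //.
    exact: inj_comp.
  by move=> u' v' Fuv' ne; rewrite /= -adjG' fG'.
- by rewrite (inj_eq enum_val_inj).
Qed.

(* An edge of F is mapped to xy, and the rest of F into the clique. *)
Lemma percolated_common_clique (V : finType) (G : sgraph V) (h : W -> V) p q x y :
    percolated G -> adj F p q -> injective h -> x != y ->
    (forall z, x != h z) -> (forall z, y != h z) ->
    (forall z z', z != z' -> adj G (h z) (h z')) ->
    (forall z, adj G x (h z)) -> (forall z, adj G y (h z)) ->
  adj G x y.
Proof.
move=> percG Fpq injh xy nx ny hh xh yh; have npq := adj_neq Fpq.
pose f z := if z == p then x else if z == q then y else h z.
have -> : x = f p by rewrite /f eqxx.
have -> : y = f q by rewrite /f eqxx eq_sym (negPf npq).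
apply: percG => // [z z' | z z' Fzz']; rewrite /f.
  case: (eqVneq z p) => [->|zp]; case: (eqVneq z' p) => [->|z'p] //.
  - by case: (eqVneq z' q) => [_ /eqP|_ /eqP]; rewrite ?(negPf xy) ?(negPf (nx _)).
  - by case: (eqVneq z q) => [_ /esym/eqP|_ /esym/eqP]; rewrite ?(negPf xy) ?(negPf (nx _)).
  case: (eqVneq z q) => [->|zq]; case: (eqVneq z' q) => [->|z'q] //.
  - by move/eqP; rewrite (negPf (ny _)).
  - by move/esym/eqP; rewrite (negPf (ny _)).
  exact: injh.
have := adj_neq Fzz'.
case: (eqVneq z p) => [->|zp]; case: (eqVneq z' p) => [->|z'p]; rewrite ?eqxx //.
- by case: (eqVneq z' q) => [->|//]; rewrite eqxx.
- by case: (eqVneq z q) => [->|_ _ _]; rewrite 1?setUC ?eqxx // adj_sym.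
case: (eqVneq z q) => [->|zq]; case: (eqVneq z' q) => [->|z'q]; rewrite ?eqxx //.
- by rewrite adj_sym.
- by move=> ? _; apply: hh.
Qed.

End Percolation.

Lemma card_ord_lt n b : b <= n -> #|[set j : 'I_n | j < b]| = b.
Proof.
move=> bn; rewrite cardsE -sum1_card -(big_ord_widen n (fun=> 1)) //.
by rewrite sum1_card card_ord.
Qed.

Lemma min_degree_le (V : finType) (G : sgraph V) x : min_degree G <= degree G x.
Proof.
rewrite /min_degree; have := mem_index_enum x; elim: (index_enum V) => // y s IHs.
rewrite inE big_cons geq_min => /orP[/eqP-> | /IHs ->]; by rewrite ?leqnn ?orbT.
Qed.

(** * The graph F, called the gadget *)

Section Gadget.
Variables (d k l : nat).
Local Notation m := d.+1.
Local Notation L := l.+1.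
(** The clique is indexed by pairs so that the vertices [(i, j)] are reserved for vertex [i] of T;
    edges from T to the clique then have distinct ends automatically. *)
Local Notation core := ('I_m * 'I_L + unit)%type.
Local Notation VF := (core + 'I_m)%type.

(* The number of edges from vertex i of T to the clique. *)
Definition outer (i : 'I_m) : nat := k.+1 %/ m + (i < k.+1 %% m).

Lemma sum_outer : \sum_i outer i = k.+1.
Proof.
rewrite big_split /= sum_nat_const card_ord [RHS](divn_eq _ m) mulnC; congr (_ + _).
rewrite -big_mkcond sum1_card /= -[RHS](@card_ord_lt m) ?cardsE //.
exact: ltnW (ltn_pmod _ _).
Qed.

Lemma outer0_gt0 : 0 < outer ord0.
Proof.
rewrite /outer addn_gt0 orbC lt0b lt0n.
have := divn_eq k.+1 m; case: (_ %% _) => [|//]; case: (_ %/ _) => //.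
Qed.

Lemma outer_le_succ i : outer i <= k.+1.
Proof. by rewrite -sum_outer (bigD1 i) //= leq_addr. Qed.

(** The shares are even: a zero share forces the quotient [k.+1 %/ m] to vanish. *)
Lemma outer0_le1 i : outer i = 0 -> outer ord0 <= 1.
Proof. by rewrite /outer; case: (_ %/ _) => //= _; apply: leq_b1. Qed.

(** This is the expansion of subsets of T, after cancelling the degrees inside T. With a and b the
    quotient and remainder of [k.+1] by [m], the sum S of the shares over [Y] is at least a|Y|, and
    bounding the shares outside [Y] by a + 1 gives S + |~: Y| >= a|Y| + b. *)
Lemma outer_subset_sum (Y : {set 'I_m}) :
    2 * k + 2 * m <= m * d -> Y != set0 ->
  2 * k * #|Y| + 2 * m <= m * (#|Y| * #|~: Y| + 2 * \sum_(i in Y) outer i).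
Proof.
move=> km; rewrite -card_gt0 => Y0; have := cardsC Y; rewrite card_ord => cY.
have a_le : #|Y| * (k.+1 %/ m) <= \sum_(i in Y) outer i.
  by rewrite -sum_nat_const; apply: leq_sum => i _; apply: leq_addr.
have a_ge : k.+1 <= \sum_(i in Y) outer i + #|~: Y| * (k.+1 %/ m).+1.
  rewrite -[leqLHS]sum_outer (bigID (mem Y)) /= leq_add2l.
  rewrite (eq_bigl (mem (~: Y))) => [|i]; last by rewrite !inE.
  rewrite -sum_nat_const; apply: leq_sum => i _.
  by rewrite /outer -[leqRHS]addn1 leq_add2l leq_b1.
move: (\sum_(i in Y) _) a_le a_ge => S.
have := divn_eq k.+1 m; have := ltn_pmod k.+1 (ltn0Sn d).
move: (_ %/ _) (_ %% _) => a b bm ka.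
move: #|Y| #|~: Y| Y0 cY => y z y0 cY le1 le2.
have {}le2 : a * y + b <= S + z by nia.
case: b => [|b] in bm ka le2 *; first by nia.
case: y => [//|[|y]] in y0 cY le1 le2 *; last first.
  have {}le2 := leq_mul (leqnn m) le2.
  have z_le : m * z * 2 <= m * z * y.+2 by rewrite leq_mul2l orbT.
  have b_eq : b * (y.+2 + z) = b * m by rewrite cY.
  have k_eq : k = a * m + b by lia.
  by rewrite k_eq; lia.
(* For a single vertex, the complement has [d] elements and the hypothesis on [k] suffices. *)
case: d => [|[|[|d']]] in km bm ka cY le1 le2 *; nia.
Qed.

(* [inl (inl _)] is the clique, [inl (inr tt)] the vertex of degree d, and
   [inr _] is T. *)
Definition gadget_rel : rel VF := fun x y =>
  match x, y with
  | inl (inl _), inl (inl _) => true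
  | inl (inr _), inl (inl (i, j)) => (i == ord0) && (j < d)
  | inr _, inr _ => true
  | inr i, inl (inl (i', j)) => (i == i') && (j < outer i)
  | _, _ => false
  end.

Definition gadget : sgraph VF := relgraph gadget_rel.

Lemma outer_le_clique (i : 'I_m) : k <= l -> outer i <= L.
Proof. by move=> kl; apply: leq_trans (outer_le_succ i) _. Qed.

(* Part of the neighbourhood of vertex i of T, when i is not in Z. *)
Definition star (Z : {set 'I_m}) (i : 'I_m) : {set VF} :=
  inr @: Z :|: [set inl (inl (i, j)) | j in [set j : 'I_L | j < outer i]].

Lemma card_star (Z : {set 'I_m}) i : k <= l -> #|star Z i| = #|Z| + outer i.
Proof.
move=> kl; rewrite cardsU disjoint_setI0 ?cards0 ?subn0.
  rewrite !card_imset ?card_ord_lt ?outer_le_clique //; last by move=> ? ? [].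
  by move=> ? ? [].
rewrite disjoint_subset; apply/subsetP => x /imsetP[i' _ ->]; rewrite !inE.
by apply/imsetP => -[].
Qed.

Lemma star_sub (Z : {set 'I_m}) i : i \notin Z ->
  star Z i \subset [set y | adj gadget (inr i) y].
Proof.
move=> iZ; rewrite subUset; apply/andP; split; apply/subsetP => x /imsetP[].
  move=> i' i'Z ->; rewrite inE adj_relgraph /= andbT.
  by apply: contraNneq iZ => -[->].
by move=> j; rewrite inE => j_lt ->; rewrite inE adj_relgraph /= eqxx j_lt.
Qed.

(** * Degrees and connectedness of the gadget *)

Lemma degree_gadget i : k <= l -> d + outer i <= degree gadget (inr i).
Proof.
move=> kl; have := subset_leq_card (@star_sub [set~ i] i _); rewrite card_star // cardsC1 card_ord.
by apply; rewrite !inE eqxx.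
Qed.

Lemma degree_extra : d <= l -> degree gadget (inl (inr tt)) = d.
Proof.
move=> dl; have inj_j : injective (fun j : 'I_L => (inl (inl (ord0, j)) : VF)) by move=> ? ? [].
rewrite -[RHS](@card_ord_lt L); last exact: leqW.
rewrite /degree -(card_imset _ inj_j); apply: eq_card => y; rewrite inE adj_relgraph.
apply/idP/imsetP => [|[j]]; last by rewrite inE => j_lt ->; rewrite /= j_lt.
by case: y => [[[i j]|[]]|i] //=; rewrite orbF => /andP[/eqP-> j_lt]; exists j; rewrite ?inE.
Qed.

Lemma degree_clique z : m * L <= (degree gadget (inl (inl z))).+1.
Proof.
pose emb z : VF := inl (inl z); have inj_emb : injective emb by move=> ? ? [].
have: emb @: [set~ z] \subset [set y | adj gadget (emb z) y].
  apply/subsetP => x /imsetP[z']; rewrite !inE => z'z ->.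
  by rewrite adj_relgraph /= andbT (inj_eq inj_emb) eq_sym.
move/subset_leq_card; rewrite card_imset // cardsC1 card_prod !card_ord -ltnS.
by apply: leq_trans; apply: leqSpred.
Qed.

Lemma connected_gadget : 0 < d -> connected gadget.
Proof.
move=> d_gt0; apply/andP; split; first by apply/card_gt0P; exists (inr ord0).
pose o : VF := inl (inl (ord0, ord0)).
have to_o x : connect (adj gadget) x o.
  have T0 : adj gadget (inr ord0) o by rewrite adj_relgraph /= outer0_gt0.
  case: x => [[z|[]]|i].
  - have [-> // | zo] := eqVneq (inl (inl z)) o.
    by apply: connect1; rewrite adj_relgraph zo.
  - by apply: connect1; rewrite adj_relgraph /= d_gt0.
  - have [-> // | i0] := eqVneq i ord0; first exact: connect1.
    apply: connect_trans (connect1 T0); apply: connect1; rewrite adj_relgraph /= andbT.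
    by apply: contra i0 => /eqP[->].
apply/forallP => x; apply/forallP => y; apply: connect_trans (to_o x) _.
by rewrite sym_connect_sym ?to_o //; apply: adj_sym.
Qed.

(** The extra vertex is there to attain the value [d]: the vertices of T may all have larger degree
    because of their edges to the clique. *)
Lemma min_degree_gadget : d <= l -> k <= l -> min_degree gadget = d.
Proof.
move=> dl kl; apply/eqP; rewrite eqn_leq; apply/andP; split.
  by rewrite -[leqRHS]degree_extra // min_degree_le.
rewrite /min_degree; elim/big_ind: _ => [|x y dx dy|x _]; last first.
- case: x => [[z|[]]|i]; first by rewrite -ltnS; apply: leq_trans (degree_clique z); apply: leq_pmulr.
    by rewrite degree_extra.
  by apply: leq_trans (degree_gadget i kl); apply: leq_addr.
- by rewrite leq_min dx.
(* The default value of the minimum is the number of vertices. *)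
by rewrite card_sum card_ord; apply: leq_trans (leqnSn d) (leq_addl _ _).
Qed.

(** This is the hypothesis [expanding] with p / q = d/2 + k/m and q = 2m. The vertices of [X] are
    split into the clique part [K], the extra vertex [w] and the part [Y] in T, and their
    contributions [D] are bounded separately. *)
Lemma gadget_expanding (X : {set VF}) :
    2 * k + 2 * m <= m * d -> 2 * d * (m + 2) + 2 + k < l -> X != set0 ->
  (m * d + 2 * k) * #|X| + 2 * m <= 2 * m * #|touching gadget X|.
Proof.
move=> km l_large X0; rewrite -mulnA mulnCA card_touching.
have [dl kl] : d <= l /\ k <= l by split; lia.
pose D x := degree gadget x + #|[set y | adj gadget x y] :\: X|.
pose Y := inr @^-1: X : {set 'I_m}; pose w : VF := inl (inr tt).
pose K := [set z | inl (inl z) \in X] : {set 'I_m * 'I_L}.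
have splitX (E : VF -> nat) : \sum_(x in X) E x =
    \sum_(z in K) E (inl (inl z)) + (w \in X) * E w + \sum_(i in Y) E (inr i).
  rewrite !big_sumType /=; congr (_ + _ + _); try by apply: eq_bigl => z; rewrite inE.
  rewrite big_mkcond (big_pred1 tt) /=; last by case.
  by case: (_ \in X); rewrite ?mul1n.
have cX : #|X| = #|K| + (w \in X) + #|Y|.
  by rewrite -[LHS]sum1_card splitX !sum1_card muln1.
rewrite cX [\sum_(x in X) _](splitX D).
have [K0 | ] := eqVneq K set0; last first.
  (* A clique vertex contributes at least [l], which outweighs all that is required for itself, [w]
     and the at most [m] vertices of [Y]. *)
  rewrite -card_gt0 => K_gt0.
  have : #|K| * l <= \sum_(z in K) D (inl (inl z)).
    rewrite -sum_nat_const; apply: leq_sum => z _; apply: leq_trans (leq_addr _ _).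
    by rewrite -ltnS; apply: leq_trans (degree_clique z); rewrite leq_pmull.
  have Y_le : #|Y| <= m by rewrite -[leqRHS]card_ord max_card.
  have w_le : (w \in X : nat) <= 1 by apply: leq_b1.
  move: (\sum_(z in K) _) (\sum_(i in Y) _) (_ * D w) => S1 S2 S3 S1_ge.
  move: (nat_of_bool _) #|K| #|Y| w_le K_gt0 Y_le S1_ge => b x y b1 x0 ym S1_ge.
  have : (m * d + 2 * k) * (x + b + y) <= 2 * m * d * (x + 1 + m).
    by apply: leq_mul; lia.
  suff : 2 * m * d * (x + 1 + m) + 2 * m <= m * (S1 + S3 + S2) by lia.
  have -> : 2 * m * d * (x + 1 + m) + 2 * m = m * (2 * d * (x + 1 + m) + 2) by lia.
  rewrite leq_mul2l; apply/orP; right; apply: leq_trans (_ : x * (2 * d * (m + 2) + 2) <= _); first by nia.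
  rewrite -addnA; apply: leq_trans (leq_addr _ _); apply: leq_trans S1_ge.
  rewrite leq_mul2l; apply/orP; right; lia.
have noK z : inl (inl z) \notin X.
  by have := in_set0 z; rewrite -K0 inE => ->.
have Dw : D w = 2 * d.
  rewrite mul2n -addnn /D degree_extra //; congr (_ + _); rewrite -[RHS]degree_extra //.
  rewrite (setDidPl _) // disjoint_subset; apply/subsetP => x; rewrite inE adj_relgraph.
  by case: x => [[z|[]]|i] //= _; rewrite !inE noK.
have Di i : i \in Y -> d + #|~: Y| + 2 * outer i <= D (inr i).
  move=> iY; have -> : d + #|~: Y| + 2 * outer i = d + outer i + (#|~: Y| + outer i) by lia.
  apply: leq_add; first exact: degree_gadget kl.
  have iY' : i \notin ~: Y by rewrite inE negbK.
  rewrite -card_star //; apply: subset_leq_card; apply/subsetP => x xs.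
  rewrite in_setD (subsetP (star_sub iY')) // andbT.
  case/setUP: xs => /imsetP[z zP ->]; last exact: noK.
  by move: zP; rewrite !inE.
rewrite K0 cards0 big_set0 add0n Dw.
have [Y0 | Y0] := eqVneq Y set0.
  (* Now X = {w}, whose [d] edges all leave [X]; the required inequality is exactly the bound on
     [k]. *)
  rewrite Y0 cards0 big_set0 !addn0.
  suff -> : w \in X by nia.
  apply: contraNT X0 => wX; apply/eqP/setP => -[[z|[]]|i]; rewrite in_set0.
  - exact: negPf (noK z).
  - exact: negPf.
  - by have := in_set0 i; rewrite -Y0 inE.
have := outer_subset_sum km Y0.
have : \sum_(i in Y) (d + #|~: Y| + 2 * outer i) <= \sum_(i in Y) D (inr i) by apply: leq_sum.
rewrite big_split /= sum_nat_const -big_distrr /=.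
move: (\sum_(i in Y) outer i) (\sum_(i in Y) _) => S T ST.
move: (nat_of_bool _) #|Y| #|~: Y| ST => b y z ST.
have ST' := leq_mul (leqnn m) ST.
have kb : b * (m * d + 2 * k) <= b * (2 * m * d) by rewrite leq_mul2l; apply/orP; right; lia.
lia.
Qed.

(** The extra vertex is mapped by [g] into the clique too, so its edges are present for free; only
    edges between T and the clique need checking, and all but one are given. *)
Lemma gadget_completion (V : finType) (G : sgraph V) (g : core -> V)
    (u : 'I_m -> V) i0 (j0 : 'I_L) :
    percolated gadget G -> injective g -> injective u ->
    (forall z i, g z != u i) ->
    (forall z z', z != z' -> adj G (g z) (g z')) ->
    (forall i i', i != i' -> adj G (u i) (u i')) ->
    (forall i (j : 'I_L), j < outer i -> (i, j) != (i0, j0) ->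
       adj G (u i) (g (inl (i, j)))) ->
    j0 < outer i0 ->
  adj G (u i0) (g (inl (i0, j0))).
Proof.
move=> percG injg inju gu gg uu ug j0_lt.
pose f (x : VF) := match x with inl z => g z | inr i => u i end.
pose x0 : VF := inr i0; pose y0 : VF := inl (inl (i0, j0)).
rewrite -[u i0]/(f x0) -[g _]/(f y0); apply: percG => [||x y].
- move=> [z|i] [z'|i']; rewrite /f => E.
  + by rewrite (injg _ _ E).
  + by have := gu z i'; rewrite E eqxx.
  + by have := gu z' i; rewrite E eqxx.
  + by rewrite (inju _ _ E).
- by rewrite adj_relgraph /= eqxx j0_lt.
suff rel_f (a b : VF) : a != b -> gadget_rel a b -> [set a; b] != [set x0; y0] ->
    adj G (f a) (f b).
  rewrite adj_relgraph => /andP[xy /orP[]]; first exact: rel_f.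
  by move=> ryx; rewrite setUC adj_sym; apply: rel_f; rewrite // eq_sym.
case: a b => [z|i] [z'|i'] //= ab rab ne.
- by apply: gg; apply: contraNneq ab => ->.
- by case: z ab rab ne.
- case: z' => [[i' j]|//] /= in ab rab ne *; case/andP: rab => /eqP def_i' j_lt.
  rewrite -{i'}def_i' in ab ne *; apply: ug => //.
  by apply: contraNneq ne => -[-> ->].
- by apply: uu; apply: contraNneq ab => ->.
Qed.

(** * The host graph for the upper bound *)

Variables r q : nat.
Local Notation VH := (VF + VF + 'I_r + 'I_q * 'I_m)%type.

(* The copies of T in the host graph lack one edge to the clique, at vertex 0. *)
Definition block_outer (i : 'I_m) : nat := outer i - (i == ord0).

(* [inl (inl _)] is a clique of size 2|V(F)|, [inl (inr _)] the leftover vertices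
   (joined to the whole clique), and [inr (t, _)] the t-th copy of T. *)
Definition host_rel : rel VH := fun x y =>
  match x, y with
  | inl _, inl (inl _) => true
  | inr (t, _), inr (t', _) => t == t'
  | inr (_, i), inl (inl (inl (inl (inl (i', j))))) => (i == i') && (j < block_outer i)
  | _, _ => false
  end.

Definition host : sgraph VH := relgraph host_rel.

(** * The closure of the host graph is complete *)

Section HostClosure.
Variable G : sgraph VH.
Hypotheses (sHG : edges host \subset edges G) (percG : percolated gadget G).

Let hub (c : VF + VF) : VH := inl (inl c).

Lemma host_sub x y : x != y -> host_rel x y -> adj G x y.
Proof.
move=> xy rxy; apply: (subsetP sHG).
by rewrite -[_ \in _]/(adj host x y) adj_relgraph xy rxy.
Qed.

Lemma inj_hub : injective hub. Proof. by move=> ? ? []. Qed.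

Lemma adj_hub c c' : c != c' -> adj G (hub c) (hub c').
Proof. by move=> cc'; apply: host_sub; rewrite ?(inj_eq inj_hub). Qed.

Lemma adj_block t i i' : i != i' -> adj G (inr (t, i)) (inr (t, i')).
Proof. by move=> ii'; apply: host_sub; rewrite /= ?eqxx //; apply: contra ii' => /eqP[->]. Qed.

(* The clique of the gadget is placed on the copy of VF not containing c, with
   one vertex redirected to c. *)
Let redirect (p : core) (c : VF + VF) (z : core) : VF + VF :=
  if z == p then c else if c is inl _ then inr (inl z) else inl (inl z).

Lemma inj_redirect p c : injective (redirect p c).
Proof.
move=> z z'; rewrite /redirect.
case: (eqVneq z p) => [->|zp]; case: (eqVneq z' p) => [->|z'p] //; by case: c => c // [].
Qed.

(** The block and the hub are cliques, so the roles of T may be permuted by [s] and the clique of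
    the gadget placed anywhere in the hub by [g]. *)
Lemma block_completion t (s : {perm 'I_m}) (g : core -> VF + VF) i0 (j0 : 'I_L) :
    injective g ->
    (forall i (j : 'I_L), j < outer i -> (i, j) != (i0, j0) ->
       adj G (inr (t, s i)) (hub (g (inl (i, j))))) ->
    j0 < outer i0 ->
  adj G (inr (t, s i0)) (hub (g (inl (i0, j0)))).
Proof.
move=> injg ug; pose u i : VH := inr (t, s i).
have inju : injective u by move=> i i' [/perm_inj].
apply: (@gadget_completion _ _ (hub \o g) u) => // [|z z' zz'|i i' ii'].
- by apply: inj_comp injg; apply: inj_hub.
- by apply: adj_hub; rewrite (inj_eq injg).
- by apply: adj_block; rewrite (inj_eq perm_inj).
Qed.

(** The only edge absent from the host is the last one at vertex 0, and it completes a copy of the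
    gadget. *)
Lemma adj_block_standard t i (j : 'I_L) : j < outer i ->
  adj G (inr (t, i)) (hub (inl (inl (inl (i, j))))).
Proof.
have std i' (j' : 'I_L) : j' < block_outer i' ->
    adj G (inr (t, i')) (hub (inl (inl (inl (i', j'))))).
  by move=> j'_lt; apply: host_sub; rewrite //= eqxx j'_lt.
move=> j_lt; have [i0 | ni0] := eqVneq i ord0; last first.
  by apply: std; rewrite /block_outer (negPf ni0) subn0.
rewrite {i}i0 in j_lt *.
have [? | j_ge] := ltnP j (block_outer ord0); first exact: std.
have := @block_completion t 1%g (fun z => inl (inl z)) ord0 j.
rewrite perm1; apply=> // [z z' []//|i' j' j'_lt ne]; rewrite perm1; apply: std.
rewrite /block_outer; case: (eqVneq i' ord0) => [i'0|_]; last by rewrite subn0.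
rewrite {i'}i'0 in j'_lt ne *; have {}ne : j' != j by apply: contraNneq ne => ->.
move: j_ge ne; rewrite /block_outer eqxx -val_eqE /=; lia.
Qed.

(** The clique is placed with its vertex [(i, ord0)] moved to [c], so that the one edge not assumed
    is the one from the block to [c]. *)
Lemma adj_block_redirect t i c : 0 < outer i ->
    (forall i' (j : 'I_L), (i', j) != (i, ord0) -> j < outer i' ->
      adj G (inr (t, i')) (hub (redirect (inl (i, ord0)) c (inl (i', j))))) ->
  adj G (inr (t, i)) (hub c).
Proof.
move=> i_pos ug.
have := @block_completion t 1%g _ i ord0 (@inj_redirect (inl (i, ord0)) c).
rewrite perm1 {2}/redirect eqxx; apply=> // i' j' j'_lt ne.
by rewrite perm1; apply: ug.
Qed.

(* First the second copy of V(F), which avoids the standard neighbours of the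
   block, then the first one. *)
Lemma adj_block_hub_pos t i c : 0 < outer i -> adj G (inr (t, i)) (hub c).
Proof.
have right i' z : 0 < outer i' -> adj G (inr (t, i')) (hub (inr z)).
  move=> i'_pos; apply: adj_block_redirect => // i2 j ne j_lt.
  by rewrite /redirect ifN //; apply: adj_block_standard.
case: c => [z|z] i_pos; last exact: right.
apply: adj_block_redirect => // i2 j ne j_lt.
by rewrite /redirect ifN //; apply: right; apply: leq_ltn_trans j_lt.
Qed.

(* When [outer i = 0], all values of outer are at most 1, and i can take the role
   of vertex 0 of T. *)
Lemma adj_block_hub t i c : adj G (inr (t, i)) (hub c).
Proof.
have [i_pos|] := posnP (outer i); last exact: adj_block_hub_pos.
have ni0 : i != ord0 by apply: contraTneq outer0_gt0 => <-; rewrite i_pos.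
have := @block_completion t (tperm ord0 i) _ ord0 ord0 (@inj_redirect (inl (ord0, ord0)) c).
rewrite tpermL {2}/redirect eqxx; apply; last exact: outer0_gt0.
move=> i' j j_lt ne.
(* Vertex 0 has a single edge to the clique, the excluded one. The remaining vertices with an edge
   to the clique differ from [i] as well, so the transposition fixes them. *)
have i'0 : i' != ord0.
  apply: contraNneq ne => i'0; rewrite i'0 in j_lt *.
  rewrite xpair_eqE eqxx -val_eqE /=.
  by have := outer0_le1 i_pos; lia.
have i'_pos : 0 < outer i' by apply: leq_ltn_trans j_lt.
have i'i : i' != i by apply: contraTneq i'_pos => ->; rewrite i_pos.
rewrite tpermD 1?eq_sym //; exact: adj_block_hub_pos.
Qed.

(** Every vertex off the hub, called a spoke, is joined to the whole hub. Two spokes become adjacent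
    by using one half of the hub as their common clique. *)
Lemma host_closure_complete x y : x != y -> adj G x y.
Proof.
pose spoke (x : VH) := if x is inl (inl _) then false else true.
have adj_spoke x' c : spoke x' -> adj G x' (hub c).
  case: x' => [[//|v]|[t i]] _; last exact: adj_block_hub.
  exact: host_sub.
have spoke_hub x' c : spoke x' -> x' != hub c by case: x' => [[]|].
have [sx|hx] := boolP (spoke x); have [sy|hy] := boolP (spoke y) => xy.
- have Fpq : adj gadget (inl (inl (ord0, ord0))) (inr ord0).
    by rewrite adj_sym adj_relgraph /= outer0_gt0.
  apply: (percolated_common_clique (h := hub \o inl) percG Fpq) xy _ _ _ _ _.
  + by apply: inj_comp inj_hub _ => ? ? [].
  + by move=> z; apply: spoke_hub.
  + by move=> z; apply: spoke_hub.
  + by move=> z z' zz'; apply: adj_hub; apply: contra zz' => /eqP[->].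
  + by move=> z; apply: adj_spoke.
  + by move=> z; apply: adj_spoke.
- by case: y hy xy => [[c|//]|//] _ _; apply: adj_spoke.
- by case: x hx xy => [[c|//]|//] _ _; rewrite adj_sym; apply: adj_spoke.
- case: x hx xy => [[c|//]|//] _; case: y hy => [[c'|//]|//] _ cc'.
  by apply: adj_hub; apply: contra cc' => /eqP->.
Qed.
End HostClosure.

(** * Counting the edges of the host graph *)

Lemma sum_block_outer : \sum_i block_outer i = k.
Proof.
have := sum_outer; rewrite (bigD1 ord0) //= (bigD1 (F := block_outer) ord0) //=.
rewrite /block_outer eqxx => sum_eq.
under eq_bigr => i /negPf-> do rewrite subn0.
by have := outer0_gt0; lia.
Qed.

(** Edges avoiding all blocks are bounded crudely by the number of vertex sets, which does not
    depend on [q]. The edges meeting blocks are counted by degrees and give the linear term. *)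
Lemma card_host_edges : k <= l ->
  2 * #|edges host| <= 2 * 2 ^ (#|{: VF + VF}| + r) + q * (m * d + 2 * k).
Proof.
move=> kl; have inj_inr : injective (inr : 'I_q * 'I_m -> VH) by move=> ? ? [].
pose B : {set VH} := inr @: [set: 'I_q * 'I_m].
rewrite (card_inside_touching host B) mulnDr; apply: leq_add.
  rewrite leq_mul2l /=; apply: leq_trans (_ : #|powerset (~: B)| <= _).
    by apply: subset_leq_card; apply/subsetP => e; rewrite !inE => /andP[].
  rewrite card_powerset leq_exp2l // -(leq_add2l #|B|) cardsC card_imset // cardsT.
  by rewrite [in leqLHS]card_sum [#|{: VF + VF + 'I_r}|]card_sum card_ord addnC.
pose J i := [set j : 'I_L | j < block_outer i].
pose hook i (j : 'I_L) : VH := inl (inl (inl (inl (inl (i, j))))).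
have cardJ i : #|J i| = block_outer i.
  by apply: card_ord_lt; apply: leq_trans (leq_subr _ _) (outer_le_clique i kl).
have deg_in t i : degree host (inr (t, i)) <= d + block_outer i.
  pose block i' : VH := inr (t, i').
  have: [set y | adj host (inr (t, i)) y] \subset block @: [set~ i] :|: hook i @: J i.
    apply/subsetP => y; rewrite inE adj_relgraph => /andP[ne].
    case: y ne => [[[[[[i' j]|//]|//]|//]|//]|[t' i']] //= ne.
      rewrite orbF => /andP[/eqP<- j_lt]; apply/setUP; right.
      by apply/imsetP; exists j; rewrite ?inE.
    rewrite [t' == t]eq_sym orbb => /eqP def_t; rewrite -{t'}def_t in ne *.
    apply/setUP; left; apply/imsetP; exists i' => //; rewrite !inE.
    by apply: contraNneq ne => ->.
  move/subset_leq_card/leq_trans; apply; apply: leq_trans (leq_card_setU _ _) _.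
  apply: leq_add; last by rewrite -cardJ leq_imset_card.
  by apply: leq_trans (leq_imset_card _ _) _; rewrite cardsC1 card_ord.
have deg_out t i : #|[set y | adj host (inr (t, i)) y] :\: B| <= block_outer i.
  rewrite -cardJ; apply: leq_trans (leq_imset_card (hook i) _); apply: subset_leq_card.
  apply/subsetP => y; rewrite in_setD inE adj_relgraph => /andP[yB /andP[_]].
  case: y yB => [[[[[[i' j]|//]|//]|//]|//]|[t' i']] //= yB; last first.
    by rewrite imset_f in yB.
  by rewrite orbF => /andP[/eqP<- j_lt]; apply: imset_f; rewrite inE.
rewrite card_touching big_imset /=; last by move=> ? ? _ _ /inj_inr.
apply: (@leq_trans (\sum_(p : 'I_q * 'I_m) (d + 2 * block_outer p.2))).
  rewrite [leqLHS](eq_bigl xpredT) => [|p]; last by rewrite inE.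
  apply: leq_sum => -[t i] _ /=; rewrite mul2n -addnn addnA.
  exact: leq_add (deg_in t i) (deg_out t i).
rewrite -(pair_big xpredT xpredT (fun t i => d + 2 * block_outer i)) /=.
rewrite sum_nat_const card_ord big_split /= sum_nat_const card_ord -big_distrr /=.
by rewrite sum_block_outer.
Qed.

End Gadget.

(** * Linear bounds for the gadget and the theorem *)

Lemma wsat_gadget_bounds d k l (w := fun n => wsat n (gadget d k l)) :
    2 * k + 2 * d.+1 <= d.+1 * d -> 2 * d * (d.+1 + 2) + 2 + k < l ->
  exists C n0, forall n, n0 <= n ->
    (d.+1 * d + 2 * k) * n <= 2 * d.+1 * w n <= (d.+1 * d + 2 * k) * n + 2 * d.+1 * C.
Proof.
move=> km l_large; have kl : k <= l by lia.
set m := d.+1; set p := m * d + 2 * k.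
pose VF := ('I_m * 'I_l.+1 + unit + 'I_m)%type; pose M := #|{: VF + VF}|.
(* The constant covers the hub and fewer than [m] leftover vertices. The threshold leaves room for
   the hub and makes [n.-1] at least [p], as the lower bound requires. *)
exists (2 ^ (M + m)), (M + p.+1) => n n_large; apply/andP; split.
  apply: wsat_lower_bound => [X|]; first exact: gadget_expanding.
  by rewrite -mulnA leq_mul2l /=; apply: leq_trans (leq_pmull _ _) => //; lia.
pose r := (n - M) %% m; pose q := (n - M) %/ m.
have n_eq : n = M + r + q * m.
  by rewrite -addnA [r + _]addnC -divn_eq subnKC //; lia.
have r_lt : r < m by apply: ltn_pmod.
have card_host : #|{: VF + VF + 'I_r + 'I_q * 'I_m}| = n.
  by rewrite card_sum [#|{: VF + VF + 'I_r}|]card_sum card_prod !card_ord n_eq.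
have := wsat_upper_bound (@host_closure_complete d k l r q).
rewrite card_host -/(w n) => w_le.
have := @card_host_edges d k l r q kl; rewrite -/m -/p -/VF -/M => e_le.
have pow_le : 2 ^ (M + r) <= 2 ^ (M + m) by rewrite leq_exp2l // leq_add2l ltnW.
have wn_le : 2 * w n <= 2 * 2 ^ (M + m) + q * p.
  apply: (@leq_trans (2 * 2 ^ (M + r) + q * p)).
    by apply: leq_trans e_le; rewrite leq_mul2l.
  by rewrite leq_add2r leq_mul2l.
have qm_le : p * (q * m) <= p * n by rewrite leq_mul2l n_eq leq_addl orbT.
have := leq_mul (leqnn m) wn_le; move: (2 ^ _) => C; lia.
Qed.

Local Open Scope ring_scope.

Theorem theorem1p2 (delta : nat) (hdelta : (2 <= delta)%N) (k : nat)
    (hk : k%:R <= (delta%:R / 2 - 1) * (delta%:R + 1) :> rat) (N : int) :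
  exists (V : finType) (F : sgraph V),
    [/\ connected F,
        min_degree F = delta,
        N <= (#|V|%:Z) &
        exists (C : rat) (n0 : nat), forall n : nat, (n0 <= n)%N ->
          `|(wsat n F)%:R - (delta%:R / 2 + k%:R / (delta%:R + 1)) * n%:R| <= C].
Proof.
pose m := delta.+1.
(* This is [hk] doubled and cleared of subtraction. *)
have km : (2 * k + 2 * m <= m * delta)%N.
  rewrite -(ler_nat rat) natrD !natrM /m -natr1; lra.
(* Large enough for the expansion, with [N] added to make the vertex set large. *)
pose l := (2 * delta * (m + 2) + 2 + k + `|N|).+1.
have l_large : (2 * delta * (m + 2) + 2 + k < l)%N by rewrite ltnS leq_addr.
exists ('I_m * 'I_l.+1 + unit + 'I_m)%type, (gadget delta k l); split.
- by apply: connected_gadget; apply: ltnW.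
- by apply: min_degree_gadget; rewrite /l; nia.
- rewrite !card_sum card_prod !card_ord card_unit.
  suff : (`|N| <= m * l.+1 + 1 + m)%N by lia.
  by apply: leq_trans (leq_addr _ _); apply: leq_trans (leq_addr _ _); rewrite /l; nia.
have [C [n0 bounds]] := wsat_gadget_bounds km l_large.
exists C%:R, n0 => n /bounds /andP[].
rewrite -/m -2!(ler_nat rat) natrD !natrM natrD !natrM.
move: (wsat _ _)%:R => w lo hi.
have m_gt0 : 0 < m%:R :> rat by rewrite ltr0n.
have -> : delta%:R + 1 = m%:R :> rat by rewrite natr1.
(* Over the denominator 2m, the numerator is the quantity that [lo] and [hi] place between 0 and
   2mC. *)
have -> : w - (delta%:R / 2 + k%:R / m%:R) * n%:R =
    (2 * m%:R * w - (m%:R * delta%:R + 2 * k%:R) * n%:R) / (2 * m%:R).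
  by field; rewrite gt_eqF.
by rewrite normrM normfV (gtr0_norm (_ : 0 < 2 * m%:R)) ?ler_pdivrMr ?mulr_gt0 // ger0_norm; lra.
Qed.
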